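(* Let $G$ be a finite, simple, undirected, connected graph. Then ${\rm dmg}(G)=1$ if and only if ${\rm rad}(G)=2$ and there is a center $c$ of $G$ such that for every $w\in V(G)\setminus N[c]$ there exists $s\in N[c]$ that dominates $w$.
   Context: ${\rm rad}$ denotes the radius; a center is a vertex of minimum eccentricity; $N(\cdot)$ and $N[\cdot]$ are open and closed neighbourhoods. A vertex $s$ dominates a vertex $w$ if $N(w)\subseteq N[s]$. Damage game on a graph: one cop and one robber; in round $0$ the cop chooses a vertex, then the robber does; in each later round the cop moves to an adjacent vertex or passes, then the robber moves to an adjacent vertex or passes; the robber is captured if the cop occupies the robber's vertex. A vertex $v$ is damaged if the robber occupies $v$ in some round $i\ge0$ and in round $i+1$ the uncaptured robber passes or moves to a neighbour. The damage number ${\rm dmg}(\cdot)$ is the number of distinct vertices damaged when the cop plays to minimize and the robber to maximize this number. *)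

(* Defs.v *)
From mathcomp Require Import all_boot.
From mathcomp Require Import boolp.

Set Implicit Arguments.
Unset Strict Implicit.
Unset Printing Implicit Defensive.

(* A graph is an adjacency relation [e] on a finite vertex type [V]; symmetry
   and irreflexivity are hypotheses of the theorem. *)

Definition connected_graph (V : finType) (e : rel V) : Prop :=
  0 < #|V| /\ forall x y : V, connect e x y.

Definition nbhd (V : finType) (e : rel V) (x : V) : {set V} := [set y | e x y].

Definition cl_nbhd (V : finType) (e : rel V) (x : V) : {set V} :=
  x |: nbhd e x.

Definition dominates (V : finType) (e : rel V) (s w : V) : bool :=
  nbhd e w \subset cl_nbhd e s.

Definition walk (V : finType) (e : rel V) (n : nat) (x y : V) : bool :=
  [exists p : n.-tuple V, path e x p && (last x p == y)].

(* A shortest walk has fewer than #|V| edges, so the default value #|V| is only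
   taken when [y] cannot be reached from [x]. *)
Definition dist (V : finType) (e : rel V) (x y : V) : nat :=
  \big[minn/#|V|]_(n < #|V| | walk e n x y) n.

Definition ecc (V : finType) (e : rel V) (x : V) : nat :=
  \max_(y : V) dist e x y.

(* No eccentricity exceeds #|V|, so the default value is harmless. *)
Definition rad (V : finType) (e : rel V) : nat :=
  \big[minn/#|V|]_(x : V) ecc e x.

Definition center (V : finType) (e : rel V) (c : V) : Prop :=
  forall x : V, ecc e c <= ecc e x.

(* A strategy maps the opponent's past positions, oldest first, to the player's
   next position (the player's own past positions are determined by these).  In
   round [i] the cop, who moves first, has seen the robber's [i] previous
   positions, and the robber has seen [i.+1] positions of the cop. *)
Definition cop_strategy (V : finType) (e : rel V) (sigma : seq V -> V) : Prop :=
  forall (rs : seq V) (r : V), sigma (rcons rs r) \in cl_nbhd e (sigma rs).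

(* The value [tau [::]] is never used: the robber's initial choice is the value
   of [tau] on a one-element sequence. *)
Definition robber_strategy (V : finType) (e : rel V) (tau : seq V -> V) : Prop :=
  forall (cs : seq V) (c : V),
    cs != [::] -> tau (rcons cs c) \in cl_nbhd e (tau cs).

(* Positions of the cop and of the robber in the rounds before round [n]. *)
Fixpoint history (V : finType) (sigma tau : seq V -> V) (n : nat) :
    seq V * seq V :=
  if n is m.+1 then
    let: (cs, rs) := history sigma tau m in
    let cs' := rcons cs (sigma rs) in
    (cs', rcons rs (tau cs'))
  else ([::], [::]).

Definition cop_pos (V : finType) (sigma tau : seq V -> V) (i : nat) : V :=
  sigma (history sigma tau i).2.

Definition robber_pos (V : finType) (sigma tau : seq V -> V) (i : nat) : V :=
  tau (history sigma tau i.+1).1.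

(* The robber is still free when it is its turn in round [i.+1]: no capture
   occurred in a round [j <= i], nor when the cop moved in round [j.+1].
   Positions are defined for all rounds, but those after a capture are
   irrelevant. *)
Definition free_at_next_turn (V : finType) (sigma tau : seq V -> V) (i : nat) :
    Prop :=
  forall j : nat, j <= i ->
    cop_pos sigma tau j <> robber_pos sigma tau j /\
    cop_pos sigma tau j.+1 <> robber_pos sigma tau j.

Definition damaged (V : finType) (sigma tau : seq V -> V) : {set V} :=
  [set v | `[< exists i : nat,
                 robber_pos sigma tau i = v /\ free_at_next_turn sigma tau i >]].

Definition cop_guarantees (V : finType) (e : rel V) (k : nat) : Prop :=
  exists sigma : seq V -> V, cop_strategy e sigma /\
    forall tau : seq V -> V, robber_strategy e tau -> #|damaged sigma tau| <= k.

(* The least [k] the cop can guarantee, i.e. the minimum over cop strategies of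
   the maximum over robber strategies of the damage, which is at most #|V|. *)
Definition dmg (V : finType) (e : rel V) : nat :=
  \big[minn/#|V|]_(k < #|V| | `[< cop_guarantees e k >]) k.

(* Main.v *)
Require Import Defs.
From mathcomp Require Import all_boot.
From mathcomp Require Import boolp.

Set Implicit Arguments.
Unset Strict Implicit.
Unset Printing Implicit Defensive.

(* Passing at his starting vertex [w], the robber damages [w] unless it lies in
   N[c], where [c] is the cop's starting vertex; so damage 0 means radius at
   most 1.  If he instead leaves [w] once the cop has moved to [s], he damages a
   second vertex unless N(w) is included in N[s]; conversely a cop who reaches
   such an [s] confines him to [w].  That [c] then has eccentricity at most 2
   comes from applying domination to a neighbour [y] of [w] outside N[c]: the
   vertex [s] of N[c] dominating [y] has [w] in N[s]. *)

Lemma bigminn_le (I : finType) (P : pred I) (F : I -> nat) (x : nat) (i : I) :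
  P i -> \big[minn/x]_(j | P j) F j <= F i.
Proof.
move=> Pi; rewrite unlock; have := mem_index_enum i.
elim: (index_enum I) => //= j s IH; rewrite inE => /predU1P[<-|/IH le_s].
  by rewrite Pi geq_minl.
by case: (P j) => //; rewrite (leq_trans (geq_minr _ _)).
Qed.

Lemma bigminn_le_id (I : finType) (P : pred I) (F : I -> nat) (x : nat) :
  \big[minn/x]_(j | P j) F j <= x.
Proof. by elim/big_rec: _ => // i m _ le_m; rewrite (leq_trans (geq_minr _ _)). Qed.

Lemma bigminn_leE (I : finType) (P : pred I) (F : I -> nat) (x k : nat) :
  \big[minn/x]_(j | P j) F j <= k -> x <= k \/ exists2 i, P i & F i <= k.
Proof.
elim/big_rec: _ => [|i m Pi IH]; first by left.
by rewrite geq_min => /orP[le_k|//]; right; exists i.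
Qed.

Section Graph.
Context (V : finType) (e : rel V).

Lemma in_cl_nbhd (x y : V) : (y \in cl_nbhd e x) = (y == x) || e x y.
Proof. by rewrite !inE. Qed.

Lemma dist_le_walk (n : nat) (x y : V) : walk e n x y -> dist e x y <= n.
Proof.
(* Walks of length at least [#|V|] are not indices of the minimum; for them the default value gives
   the bound. *)
move=> wn; have [ltn|len] := ltnP n #|V|; last first.
  exact: leq_trans (bigminn_le_id _ _ _) len.
exact: (@bigminn_le _ (fun i : 'I_#|V| => walk e i x y) _ _ (Ordinal ltn)).
Qed.

Lemma dist_le1 (x y : V) : (dist e x y <= 1) = (y \in cl_nbhd e x).
Proof.
rewrite in_cl_nbhd; apply/idP/idP => [|/predU1P[->|exy]].
(* A default value [#|V|] of at most 1 means a single vertex, hence [y = x]. *)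
- case/bigminn_leE=> [/card_le1_eqP eqV|[i + le1]].
    by rewrite (eqV y x) ?eqxx.
  case: i le1 => -[|[|//]] ? /= _.
    by case/existsP=> p; rewrite tuple0 /= eq_sym => ->.
  case/existsP; case/tupleP=> z p; rewrite tuple0 /= andbT.
  by case/andP=> exz /eqP <-; rewrite exz orbT.
- rewrite (@leq_trans 0) // dist_le_walk //.
  by apply/existsP; exists [tuple] => /=.
- by rewrite dist_le_walk //; apply/existsP; exists [tuple y]; rewrite /= exy /=.
Qed.

Lemma dist_le2 (x s y : V) :
  s \in cl_nbhd e x -> y \in cl_nbhd e s -> dist e x y <= 2.
Proof.
rewrite !in_cl_nbhd => /predU1P[->|exs] /predU1P[->|esy].
- by rewrite leqW // dist_le1 in_cl_nbhd eqxx.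
- by rewrite leqW // dist_le1 in_cl_nbhd esy orbT.
- by rewrite leqW // dist_le1 in_cl_nbhd exs orbT.
by rewrite dist_le_walk //; apply/existsP; exists [tuple s; y]; rewrite /= exs esy /=.
Qed.

Lemma rad_le1P :
  0 < #|V| -> (rad e <= 1) <-> exists c, forall w, w \in cl_nbhd e c.
Proof.
move=> /card_gt0P[v _]; rewrite /rad; split=> [/bigminn_leE|[c univ_c]].
  case=> [/card_le1_eqP eqV|[c _ /bigmax_leqP ecc1]].
    by exists v => w; rewrite in_cl_nbhd (eqV w v) ?eqxx.
  by exists c => w; rewrite -dist_le1 ecc1.
apply: leq_trans (bigminn_le (ecc e) _ (i := c) isT) _.
by apply/bigmax_leqP => w _; rewrite dist_le1.
Qed.

Section Play.
Variables sigma tau : seq V -> V.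

Lemma history_rcons (n : nat) :
  history sigma tau n.+1 =
  (rcons (history sigma tau n).1 (cop_pos sigma tau n),
   rcons (history sigma tau n).2 (robber_pos sigma tau n)).
Proof. by rewrite /robber_pos /cop_pos /=; case: history. Qed.

Lemma robber_pos_step (i : nat) :
  robber_strategy e tau ->
  robber_pos sigma tau i.+1 \in cl_nbhd e (robber_pos sigma tau i).
Proof.
move=> legal; rewrite {1}/robber_pos (history_rcons i.+1).
(* Legality of [tau] constrains only moves after a nonempty history; before round [i.+1] the history
   is a [rcons]. *)
by apply: legal; rewrite history_rcons /=; case: (history _ _ _).1.
Qed.

Lemma free_at_next_turnS (i : nat) :
  free_at_next_turn sigma tau i.+1 -> free_at_next_turn sigma tau i.
Proof. by move=> free j /leqW; apply: free. Qed.

End Play.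

Section Chase.
Variables (c : V) (next : V -> V -> V).
Hypothesis next_legal : forall s r, next s r \in cl_nbhd e s.

(** Folding [next] over the robber's past positions recomputes the cop's own position, so a rule on
    the two current positions becomes a strategy on histories. *)
Lemma foldl_cop_strategy : cop_strategy e (foldl next c).
Proof. by move=> rs r; rewrite foldl_rcons. Qed.

Lemma cop_pos_foldl (tau : seq V -> V) (i : nat) :
  cop_pos (foldl next c) tau i.+1 =
  next (cop_pos (foldl next c) tau i) (robber_pos (foldl next c) tau i).
Proof. by rewrite {1}/cop_pos history_rcons /= foldl_rcons. Qed.

End Chase.

(** In round 0 the robber has seen exactly one cop position, so he starts at [w] and is at [x] from
    round 1 on, whatever the cop does. *)
Definition start_then (w x : V) (cs : seq V) : V :=
  if size cs <= 1 then w else x.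

Lemma start_then_strategy (w x : V) :
  x \in cl_nbhd e w -> robber_strategy e (start_then w x).
Proof.
move=> xw [//|c0 [|c1 cs]] c _; rewrite /start_then //= .
by rewrite in_cl_nbhd eqxx.
Qed.

Lemma damaged_start (sigma : seq V -> V) (w x : V) :
  cop_strategy e sigma -> w \notin cl_nbhd e (sigma [::]) ->
  w \in damaged sigma (start_then w x).
Proof.
move=> legal w_far; rewrite inE; apply/asboolP; exists 0; split=> // j.
rewrite leqn0 => /eqP->; rewrite /cop_pos /robber_pos /start_then /=.
split=> eq_p; move: w_far; first by rewrite -eq_p in_cl_nbhd eqxx.
by rewrite -{1}eq_p (legal [::]).
Qed.

(** The cop's reply to the start [w] is [sigma [:: w]]. From there he neither meets the robber at
    [x] in round 1 nor reaches [x] in round 2. *)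
Lemma damaged_second (sigma : seq V -> V) (w x : V) :
  cop_strategy e sigma -> w \notin cl_nbhd e (sigma [::]) ->
  x \notin cl_nbhd e (sigma [:: w]) ->
  x \in damaged sigma (start_then w x).
Proof.
move=> legal w_far x_far; rewrite inE; apply/asboolP; exists 1; split=> //.
move=> [|[|//]] _; rewrite /cop_pos /robber_pos /start_then /=; split=> eq_p.
- by move: w_far; rewrite -eq_p in_cl_nbhd eqxx.
- by move: w_far; rewrite -{1}eq_p (legal [::]).
- by move: x_far; rewrite -eq_p in_cl_nbhd eqxx.
- by move: x_far; rewrite -{1}eq_p (legal [:: w]).
Qed.

Lemma cop_guarantees0P :
  cop_guarantees e 0 <-> exists c, forall w, w \in cl_nbhd e c.
Proof.
split=> [[sigma [legal bound]]|[c univ_c]].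
  exists (sigma [::]) => w; apply: contraT => w_far.
  have := bound (start_then w w); rewrite leqn0 cards_eq0 => eq0.
  have := damaged_start w legal w_far; rewrite (eqP (eq0 _)) ?inE //.
  by apply: start_then_strategy; rewrite in_cl_nbhd eqxx.
pose next s r := if r \in cl_nbhd e s then r else s.
have next_legal s r : next s r \in cl_nbhd e s.
  by rewrite /next; case: ifP => // _; rewrite in_cl_nbhd eqxx.
exists (foldl next c); split; first exact: foldl_cop_strategy.
move=> tau legal; rewrite leqn0 cards_eq0; apply/eqP/setP => v.
rewrite in_set0; apply/negbTE; rewrite inE; apply/asboolP => -[i [_ free]].
(* The cop reaches the robber's start by round 1, so freedom fails at round 0 already, whatever [i]
   is. *)
by have [_] := free 0 isT; apply; rewrite cop_pos_foldl /next univ_c.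
Qed.

Lemma cop_guarantees1_dominates (c : V) :
  (forall w, w \notin cl_nbhd e c ->
     exists s, s \in cl_nbhd e c /\ dominates e s w) ->
  cop_guarantees e 1.
Proof.
move=> dom_c.
(* The default [c] keeps the cop's move legal when no vertex of N[c] dominates [w]. *)
pose guard w := odflt c [pick s | (s \in cl_nbhd e c) && dominates e s w].
have guard_near w : guard w \in cl_nbhd e c.
  by rewrite /guard; case: pickP => [s /andP[]//|_]; rewrite in_cl_nbhd eqxx.
have guard_dom w : w \notin cl_nbhd e c -> dominates e (guard w) w.
  move=> /dom_c[s [s_near s_dom]]; rewrite /guard.
  by case: pickP => [t /andP[]//|/(_ s)]; rewrite s_near s_dom.
(* The cop captures if he can; otherwise he goes from [c] to the guard of the robber's vertex and
   waits there. *)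
pose next s r :=
  if r \in cl_nbhd e s then r else if s == c then guard r else s.
have next_legal s r : next s r \in cl_nbhd e s.
  rewrite /next; case: ifP => // _; case: eqP => [->|_] //.
  by rewrite in_cl_nbhd eqxx.
exists (foldl next c); split; first exact: foldl_cop_strategy.
move=> tau legal; set sigma := foldl next c; set w := robber_pos sigma tau 0.
(* The cop moves first in each round, so his position in round [i.+1] answers the robber's in round
   [i]. *)
have stay i : free_at_next_turn sigma tau i ->
    [/\ robber_pos sigma tau i = w, cop_pos sigma tau i.+1 = guard w
       & w \notin cl_nbhd e c].
  elim: i => [|i IH] free.
    have [_] := free 0 isT; rewrite cop_pos_foldl -/sigma -/w.
    rewrite /next [cop_pos _ _ 0]/=; case: ifP => // /negbT w_far _.
    by rewrite eqxx.
  have [eq_r eq_c w_far] := IH (free_at_next_turnS free).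
  have [_] := free i.+1 (leqnn _); rewrite (cop_pos_foldl _ _ _ i.+1) -/sigma eq_c.
  rewrite /next; case: ifP => // /negbT r_far _.
  have := robber_pos_step sigma i legal; rewrite eq_r in_cl_nbhd.
  (* If the guard of [w] is [c] itself, the rule sends the cop to that guard again, so he still
     stays put. *)
  case/predU1P=> [->|adj]; first by split=> //; case: eqP.
  (* Leaving [w] puts the robber in N(w), hence within reach of the guard, against his being
     free. *)
  have /subsetP/(_ (robber_pos sigma tau i.+1)) := guard_dom _ w_far.
  by rewrite inE => /(_ adj); rewrite (negbTE r_far).
rewrite -(cards1 w); apply/subset_leq_card/subsetP => v.
by rewrite !inE => /asboolP[i [<- /stay[-> _ _]]].
Qed.

Lemma cop_guarantees1_dominated (sigma : seq V -> V) (w : V) :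
  irreflexive e -> cop_strategy e sigma ->
  (forall tau, robber_strategy e tau -> #|damaged sigma tau| <= 1) ->
  w \notin cl_nbhd e (sigma [::]) -> dominates e (sigma [:: w]) w.
Proof.
move=> e_irr legal bound w_far; apply/subsetP => x; rewrite inE => ewx.
apply: contraT => x_far.
have /bound/card_le1_eqP eq_dmg : robber_strategy e (start_then w x).
  by apply: start_then_strategy; rewrite in_cl_nbhd ewx orbT.
have eq_xw : x = w.
  by apply: eq_dmg; [exact: damaged_start | exact: damaged_second].
by rewrite eq_xw e_irr in ewx.
Qed.

Lemma ecc_le2 (c : V) :
  symmetric e -> (forall x y, connect e x y) ->
  (forall w, w \notin cl_nbhd e c ->
     exists s, s \in cl_nbhd e c /\ dominates e s w) ->
  ecc e c <= 2.
Proof.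
move=> e_sym conn dom_c; apply/bigmax_leqP => w _.
have [near|w_far] := boolP (w \in cl_nbhd e c).
  by rewrite leqW // dist_le1.
(* Connectedness supplies a neighbour [y] of [w]: the first step of a path to [c]. *)
have [[|y p]] := connectP (conn w c) => /= [_ eq_c|/andP[ewy _] _].
  by rewrite eq_c in_cl_nbhd eqxx in w_far.
have [near|/dom_c[s [s_near /subsetP/(_ w)]]] := boolP (y \in cl_nbhd e c).
  by apply: dist_le2 near _; rewrite in_cl_nbhd e_sym ewy orbT.
by rewrite inE e_sym => /(_ ewy); apply: dist_le2.
Qed.

(** The bound on [k] excludes the default value and makes [k] an index of the minimum; a guarantee
    for a smaller number also holds for [k]. *)
Lemma dmg_leP (k : nat) : k < #|V| -> dmg e <= k <-> cop_guarantees e k.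
Proof.
move=> ltk; split=> [/bigminn_leE[|[j /asboolP[sigma [legal bound]] lejk]]|gk].
- by rewrite leqNgt ltk.
- by exists sigma; split=> // tau /bound /leq_trans; apply.
apply: (@bigminn_le _ (fun j : 'I_#|V| => `[< cop_guarantees e j >]) _ _
  (Ordinal ltk)).
exact/asboolP.
Qed.

End Graph.

Theorem theorem26 (V : finType) (e : rel V)
    (e_sym : symmetric e) (e_irr : irreflexive e)
    (e_conn : connected_graph e) :
  dmg e = 1 <->
  (rad e = 2 /\
   exists c : V, center e c /\
     forall w : V, w \notin cl_nbhd e c ->
       exists s : V, s \in cl_nbhd e c /\ dominates e s w).
Proof.
have [V_gt0 conn] := e_conn.
(* Both sides say that some closed neighbourhood is the whole graph. *)
have dmg0_rad : dmg e <= 0 <-> rad e <= 1.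
  by rewrite dmg_leP // cop_guarantees0P rad_le1P.
split=> [dmg1|[rad2 [c [_ dom_c]]]].
  have rad_gt1 : 1 < rad e by rewrite ltnNge; apply/negP => /dmg0_rad; rewrite dmg1.
  have V_gt1 : 1 < #|V| by apply: leq_trans rad_gt1 _; exact: bigminn_le_id.
  have [sigma [legal bound]] : cop_guarantees e 1 by apply/dmg_leP; rewrite ?dmg1.
  (* The center is the cop's start, and the dominating vertex is his reply to a robber starting at
     [w]. *)
  have dom_c w : w \notin cl_nbhd e (sigma [::]) ->
      exists s, s \in cl_nbhd e (sigma [::]) /\ dominates e s w.
    move=> w_far; exists (sigma [:: w]); split; first exact: (legal [::]).
    exact: cop_guarantees1_dominated.
  have ecc_c := ecc_le2 e_sym conn dom_c.
  have rad_le_ecc x : rad e <= ecc e x by exact: bigminn_le.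
  split; last first.
    (* Eccentricity at most 2 is minimal because the radius exceeds 1. *)
    exists (sigma [::]); split=> // x.
    exact: leq_trans ecc_c (leq_trans rad_gt1 (rad_le_ecc x)).
  by apply/eqP; rewrite eqn_leq rad_gt1 (leq_trans (rad_le_ecc _) ecc_c).
have dmg_gt0 : 0 < dmg e.
  by rewrite ltnNge; apply/negP => /dmg0_rad; rewrite rad2.
have V_gt1 : 1 < #|V|.
  by rewrite -rad2; exact: bigminn_le_id.
apply/eqP; rewrite eqn_leq dmg_gt0 andbT.
by apply/dmg_leP => //; exact: cop_guarantees1_dominates dom_c.
Qed.
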